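(* (Separation theorem for separative algebras) Let $\underline{X}=(X,\cdot,+)$ be a separative algebra. If $F_0$ is a filter in $X$, $I_0$ is an ideal in $X$ and $F_0\cap I_0=\emptyset$, then there exist a prime filter $F$ and a prime ideal $I$ in $X$ such that $F_0\subseteq F$, $I_0\subseteq I$ and $F\cap I=\emptyset$.
   Context: A multivalued binary operation on $X$ assigns to each pair of elements of $X$ a subset of $X$ (possibly empty); it is extended to subsets by $A\cdot B=\bigcup_{a\in A,b\in B}a\cdot b$ and $A+B=\bigcup_{a\in A,b\in B}(a+b)$, and singletons $\{x\}$ are written $x$. A preseparative algebra is a system $(X,\cdot,+)$ with $X\neq\emptyset$ and $\cdot,+$ multivalued binary operations on $X$ such that for all $a,b,c,d,x\in X$: (i) $ab=ba$; (i') $a+b=b+a$; (ii) $a(bc)=(ab)c$; (ii') $a+(b+c)=(a+b)+c$; (iii) if $a\in b+x$ and $c\in dx$ then $(ad)\cap(b+c)\neq\emptyset$. A subset $F\subseteq X$ is a filter if $F\cdot F\subseteq F$; a subset $I\subseteq X$ is an ideal if $I+I\subseteq I$ (the empty set and $X$ are allowed). A prime filter is a filter $F$ such that $X\setminus F$ is an ideal; a prime ideal is an ideal $I$ such that $X\setminus I$ is a filter. For $A\subseteq X$, $\mu(A)$ is the smallest filter containing $A$ and $\alpha(A)$ is the smallest ideal containing $A$; write $\mu(x)=\mu(\{x\})$, $\alpha(x)=\alpha(\{x\})$. For $x,y\in X$ put $x\le y$ iff $\mu(x)\cap\alpha(y)\neq\emptyset$. A separative algebra is a preseparative algebra in which the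 relation $\le$ is transitive. *)

(* Defs.v *)
From mathcomp Require Import all_boot all_order classical_sets.

Set Implicit Arguments.
Unset Strict Implicit.
Unset Printing Implicit Defensive.

Local Open Scope classical_set_scope.

(* Values of a multivalued operation may be empty. *)
Definition multiop (X : Type) := X -> X -> set X.

Definition set_multiop (X : Type) (op : multiop X) (A B : set X) : set X :=
  \bigcup_(a in A) \bigcup_(b in B) op a b.

Record preseparative (X : Type) (mul add : multiop X) : Prop := {
  presep_nonempty : [set: X] !=set0 ;
  presep_mulC : forall a b, mul a b = mul b a ;
  presep_addC : forall a b, add a b = add b a ;
  presep_mulA : forall a b c,
    set_multiop mul [set a] (mul b c) = set_multiop mul (mul a b) [set c] ;
  presep_addA : forall a b c,
    set_multiop add [set a] (add b c) = set_multiop add (add a b) [set c] ;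
  presep_exchange : forall a b c d x,
    add b x a -> mul d x c -> mul a d `&` add b c !=set0 }.

Definition is_filter (X : Type) (mul : multiop X) (F : set X) : Prop :=
  set_multiop mul F F `<=` F.

Definition is_ideal (X : Type) (add : multiop X) (I : set X) : Prop :=
  set_multiop add I I `<=` I.

Definition prime_filter (X : Type) (mul add : multiop X) (F : set X) : Prop :=
  is_filter mul F /\ is_ideal add (~` F).

Definition prime_ideal (X : Type) (mul add : multiop X) (I : set X) : Prop :=
  is_ideal add I /\ is_filter mul (~` I).

Definition filter_gen (X : Type) (mul : multiop X) (A : set X) : set X :=
  smallest (is_filter mul) A.

Definition ideal_gen (X : Type) (add : multiop X) (A : set X) : set X :=
  smallest (is_ideal add) A.

Definition sep_le (X : Type) (mul add : multiop X) (x y : X) : Prop :=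
  filter_gen mul [set x] `&` ideal_gen add [set y] !=set0.

Record separative (X : Type) (mul add : multiop X) : Prop := {
  separative_presep : preseparative mul add ;
  separative_trans : forall x y z,
    sep_le mul add x y -> sep_le mul add y z -> sep_le mul add x z }.

(* Main.v *)
Require Import Defs.
From mathcomp Require Import all_boot all_order boolp classical_sets.

(** By Zorn's lemma enlarge [F0] to a maximal filter [F] disjoint from [I0],
    then [I0] to a maximal ideal [I] disjoint from [F].  It suffices that [F]
    and [I] cover [X].  Otherwise some [x] lies outside both, and maximality
    gives [y] in [filter_gen x] with [y] in [I] or [F y] meeting [I], and [z] in
    [ideal_gen x] with [z] in [F] or [I + z] meeting [F].  Then [z <= x <= y],
    so by transitivity some [e] lies in [filter_gen z] and [ideal_gen y].  By
    the exchange axiom the set of those [t] for which [I + t] meets [F] is a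
    filter, and dually, so [e] inherits the property of [z] and that of [y];
    the exchange axiom then yields a common point of [F] and [I]. *)

Local Open Scope classical_set_scope.

Section CommutativeAssociative.
Variables (X : Type) (op : multiop X).
Hypothesis opC : forall a b, op a b = op b a.
Hypothesis opA : forall a b c,
  set_multiop op [set a] (op b c) = set_multiop op (op a b) [set c].

(** [is_ideal add] and [is_filter add] are convertible, so the filter lemmas of this section also
    serve for ideals. *)
Lemma is_filterP (F : set X) :
  is_filter op F <-> forall a b c, F a -> F b -> op a b c -> F c.
Proof.
split=> [FF a b c Fa Fb abc | FF c [a Fa [b Fb abc]]]; last exact: FF abc.
by apply: FF; exists a => //; exists b.
Qed.

Lemma multiopA a b c v w :
  op b c v -> op a v w -> exists2 u, op a b u & op u c w.
Proof.
move=> bcv avw.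
have : set_multiop op [set a] (op b c) w by exists a => //; exists v.
by rewrite opA => -[u abu [_ -> ucw]]; exists u.
Qed.

Lemma multiopAr a b c u w :
  op a b u -> op u c w -> exists2 v, op b c v & op a v w.
Proof.
move=> abu ucw.
have : set_multiop op (op a b) [set c] w by exists u => //; exists c.
by rewrite -opA => -[_ -> [v bcv avw]]; exists v.
Qed.

Lemma is_filter_filter_gen (A : set X) : is_filter op (filter_gen op A).
Proof.
apply/is_filterP => a b c Aa Ab abc F [FF AF].
move/is_filterP: (FF) => FP.
by apply: FP abc; [apply: Aa | apply: Ab].
Qed.

(** Commutativity and associativity gather the factors from [A] and those from [B], and each group
    stays in its own filter. With no unit available, [A] and [B] must be adjoined to the
    products. *)
Lemma is_filter_join (A B : set X) : is_filter op A -> is_filter op B ->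
  is_filter op (A `|` B `|` set_multiop op A B).
Proof.
move=> /is_filterP FA /is_filterP FB; set N := _ `|` _.
have NM a b c : A a -> B b -> op a b c -> N c.
  by move=> Aa Bb abc; right; exists a => //; exists b.
have AN a b c : A a -> N b -> op a b c -> N c.
  move=> Aa [[Ab|Bb]|[a' Aa' [b' Bb' abb]]] abc.
  - by left; left; apply: FA abc.
  - exact: NM abc.
  - have [u aau ubc] := multiopA _ _ _ _ _ abb abc.
    by apply: NM ubc => //; apply: FA aau.
have BN a b c : B a -> N b -> op a b c -> N c.
  move=> Ba [[Ab|Bb]|[a' Aa' [b' Bb' abb]]] abc.
  - by rewrite opC in abc; apply: NM abc.
  - by left; right; apply: FB abc.
  - rewrite opC in abc.
    have [v bav avc] := multiopAr _ _ _ _ _ abb abc.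
    by apply: NM avc => //; apply: FB bav.
apply/is_filterP => a b c [[Aa|Ba]|[a' Aa' [b' Bb' aba]]] Nb abc.
- exact: AN abc.
- exact: BN abc.
have [v bv avc] := multiopAr _ _ _ _ _ aba abc.
by apply: AN avc => //; apply: BN bv.
Qed.

(** Zorn's lemma applies because two factors from the union of a chain already lie in one member. *)
Lemma exists_maximal_filter (F J : set X) :
  is_filter op F -> F `&` J = set0 ->
  exists M : set X, [/\ is_filter op M, F `<=` M, M `&` J = set0 &
    forall N, is_filter op N -> M `<=` N -> N `&` J = set0 -> N `<=` M].
Proof.
move=> FF FJ.
(* [F `|` A] rather than [F `<=` A], so that the empty chain has a bound. *)
pose P := [set A : set X | is_filter op (F `|` A) /\ (F `|` A) `&` J = set0].
have [|M [[FM MJ] Mmax]] := Zorn_bigcup (P := P).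
  move=> C CP Ctot; split; last first.
    rewrite -subset0 => x [[Fx|[A CA Ax]] Jx]; first by rewrite -FJ.
    by have [_ <-] := CP _ CA; split=> //; right.
  have CF A a b c : C A -> (F `|` A) a -> (F `|` A) b -> op a b c ->
      (F `|` \bigcup_(B in C) B) c.
    move=> CA Fa Fb abc; have [/is_filterP FA _] := CP _ CA.
    by case: (FA _ _ _ Fa Fb abc) => [|Ac]; [left | right; exists A].
  apply/is_filterP => a b c [Fa|[A CA Aa]] [Fb|[B CB Bb]] abc.
  - by left; move/is_filterP: FF => FP; apply: FP abc.
  - by apply: (CF B _ _ _ _ _ _ abc) => //; [left | right].
  - by apply: (CF A _ _ _ _ _ _ abc) => //; [right | left].
  - have [AB|BA] := Ctot _ _ CA CB.
    + by apply: (CF B _ _ _ _ _ _ abc) => //; right => //; apply: AB.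
    + by apply: (CF A _ _ _ _ _ _ abc) => //; right => //; apply: BA.
exists (F `|` M); split=> // N FN MN NJ x Nx.
apply: contrapT => Mx.
have FUN : F `|` N = N by apply/setUidPr => y Fy; apply: MN; left.
apply: (Mmax N); last by split; rewrite FUN.
split; first by move=> y My; apply: MN; right.
by move=> NM; apply: Mx; right; apply: NM.
Qed.

(** By maximality the join of [F] with the filter of [x] meets [J]. The common point is not in [F],
    and the other two pieces of the join give the two alternatives. *)
Lemma maximal_filter_meet (F J : set X) (x : X) : is_filter op F ->
  F `&` J = set0 ->
  (forall N, is_filter op N -> F `<=` N -> N `&` J = set0 -> N `<=` F) ->
  ~ F x ->
  exists2 y, filter_gen op [set x] y &
    J y \/ exists f c, [/\ F f, J c & op f y c].
Proof.
move=> FF FJ Fmax Fx.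
pose N := F `|` filter_gen op [set x] `|` set_multiop op F (filter_gen op [set x]).
have xx : filter_gen op [set x] x by move=> A [_]; apply.
have : N `&` J !=set0.
  apply/set0P/eqP => NJ; apply: Fx; apply: (Fmax N) => //.
  - exact: is_filter_join FF (is_filter_filter_gen _).
  - by move=> y Fy; left; left.
  - by left; right.
move=> [c [[[Fc|xc]|[f Ff [y xy fyc]]] Jc]].
- by have : set0 c by rewrite -FJ.
- by exists c => //; left.
- by exists y => //; right; exists f, c.
Qed.

End CommutativeAssociative.

(** Exchange is self-dual: up to commutativity, duality only swaps its two premises. *)
Lemma preseparative_dual {X : Type} {mul add : multiop X} :
  preseparative mul add -> preseparative add mul.
Proof.
move=> [X0 mulC addC mulA addA exch]; split=> // a b c d x bxa dxc.
by have [z []] := exch _ _ _ _ _ dxc bxa; rewrite mulC addC => ? ?; exists z.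
Qed.

Lemma is_filter_translate {X : Type} {mul add : multiop X} {F I : set X} :
  preseparative mul add -> is_filter mul F -> is_ideal add I ->
  is_filter mul [set e | exists i a, [/\ I i, F a & add i e a]].
Proof.
move=> [_ mulC addC mulA addA exch] /is_filterP FF /is_filterP II.
apply/is_filterP => d e w [i [a [Ii Fa ida]]] [j [b [Ij Fb jeb]]] dew.
rewrite mulC in dew.
(* The first exchange replaces [d] by [a], the second [e] by [b]; this yields [g] in both [b * a]
   and [j + (i + w)]. *)
have [v [aev iwv]] := exch _ _ _ _ _ ida dew.
have [g [bag jvg]] := exch _ _ _ _ _ jeb aev.
have [k jik kwg] := multiopA X add addA _ _ _ _ _ iwv jvg.
by exists k, g; split=> //; [apply: II jik | apply: FF bag].
Qed.

Lemma filter_gen_sub (X : Type) (mul : multiop X) (F : set X) (x : X) :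
  is_filter mul F -> F x -> filter_gen mul [set x] `<=` F.
Proof. by move=> FF Fx; apply: smallest_sub => // _ ->. Qed.

Theorem theorem3p4p2 (X : Type) (mul add : multiop X)
    (sepX : separative mul add) (F0 I0 : set X)
    (filterF0 : is_filter mul F0) (idealI0 : is_ideal add I0)
    (disj0 : F0 `&` I0 = set0) :
  exists F I : set X,
    [/\ prime_filter mul add F, prime_ideal mul add I,
        F0 `<=` F, I0 `<=` I & F `&` I = set0].
Proof.
have [preX letrans] := sepX.
have [_ mulC addC mulA addA exch] := preX.
have [F [FF F0F FI0 Fmax0]] := exists_maximal_filter _ _ _ _ filterF0 disj0.
have IF0 : I0 `&` F = set0 by rewrite setIC.
have [I [II I0I IF Imax]] := exists_maximal_filter _ _ _ _ idealI0 IF0.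
have FI : F `&` I = set0 by rewrite setIC.
(* Maximality relative to [I0] passes to the larger set [I]. *)
have Fmax N : is_filter mul N -> F `<=` N -> N `&` I = set0 -> N `<=` F.
  move=> FN FsN NI; apply: Fmax0 => //.
  by apply: subsetI_eq0 NI.
have FIF x : F x -> I x -> False.
  by move=> Fx Ix; have : set0 x by rewrite -FI.
have FP := (is_filterP _ _ _).1 FF; have IP := (is_filterP _ _ _).1 II.
have cover x : ~ F x -> I x.
  move=> nFx; apply: contrapT => nIx.
  have [y xy Hy] := maximal_filter_meet _ _ mulC mulA _ _ _ FF FI Fmax nFx.
  have [z xz Hz] := maximal_filter_meet _ _ addC addA _ _ _ II IF Imax nIx.
  (* A generated filter or ideal contains its generator, so [z] and [y] themselves witness the two
     relations. *)
  have zx : sep_le mul add z x by exists z; split=> // A [_]; apply.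
  have xley : sep_le mul add x y by exists y; split=> // A [_]; apply.
  have [e [ze ye]] := letrans _ _ _ zx xley.
  have He : F e \/ exists i a, [/\ I i, F a & add i e a].
    case: Hz => [Fz|Uz]; [left|right].
      exact: (filter_gen_sub _ _ _ _ FF Fz).
    exact: (filter_gen_sub _ _ _ _ (is_filter_translate preX FF II) Uz).
  have Ke : I e \/ exists f c, [/\ F f, I c & mul f e c].
    case: Hy => [Iy|Vy]; [left|right].
      exact: (filter_gen_sub _ add _ _ II Iy).
    exact: (filter_gen_sub _ add _ _
      (is_filter_translate (preseparative_dual preX) II FF) Vy).
  case: He Ke => [Fe|[i [a [Ii Fa iea]]]] [Ie|[f [c [Ff Ic fec]]]].
  - exact: FIF Ie.
  - by apply: (FIF c) => //; apply: FP fec.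
  - by apply: (FIF a) => //; apply: IP iea.
  - have [g [afg icg]] := exch _ _ _ _ _ iea fec.
    by apply: (FIF g); [apply: FP afg | apply: IP icg].
have FC : ~` F = I.
  by apply/seteqP; split=> x; [apply: cover | move=> Ix Fx; apply: FIF Ix].
exists F, I; split=> //; split=> //; first by rewrite FC.
by rewrite -FC setCK.
Qed.
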